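(* Let $\phi:[0,\infty)\times E_k\to E_k$ be a solution of a generalised system, let $\psi(\eta)=\phi(1,\eta)$, let $T\eta=\psi(\eta)$, and let $\psi_n$ be the $n$-th iterate of $\psi$. If for some positive integer $m$ the operator $T^m$ has a fixed point $\eta$ on the torus (i.e. $\psi_m(\eta)=\eta+q$ for some $q\in\mathbb{Z}^k$), then the limit vector $$\rho=\lim_{n\to\infty}\frac{\psi_n(\eta)}{n}$$ exists at this point $\eta$, and all the elements of $\rho$ are rational.
   Context: $E_k$ ($k\ge1$) denotes the space $\mathbb{R}^k$ with norm $\|X\|=\max_{1\le p\le k}|x_p|$. A solution of a generalised system is a (jointly) continuous function $\phi:[0,\infty)\times E_k\to E_k$ such that, with $\psi(\eta)=\phi(1,\eta)$, one has $\phi(0,\eta)=\eta$, $\phi(t,\eta+q)=\phi(t,\eta)+q$, $\psi(\eta+q)=\psi(\eta)+q$ and $\phi(t+1,\eta)=\phi(t,\psi(\eta))$ for all $t\ge0$, $\eta\in E_k$, $q\in\mathbb{Z}^k$. The iterates are $\psi_0(\eta)=\eta$, $\psi_n(\eta)=\psi(\psi_{n-1}(\eta))$ for $n\ge1$. Points of $E_k$ differing by a vector of $\mathbb{Z}^k$ are regarded as identical (points of the torus), so ''fixed point of $T^m$'' means a point $\eta\in E_k$ with $\psi_m(\eta)-\eta\in\mathbb{Z}^k$. *)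

(* Defs.v *)
From mathcomp Require Import all_boot all_order all_algebra.
From mathcomp Require Import all_classical all_reals topology normedtype.

Set Implicit Arguments.
Unset Strict Implicit.
Unset Printing Implicit Defensive.

Import GRing.Theory Num.Theory.
Import numFieldNormedType.Exports.

Local Open Scope classical_set_scope.
Local Open Scope ring_scope.

(* E_k is 'rV[R]_k: its library norm is the max norm. *)

Definition intvec (R : realType) (k : nat) (q : 'rV[int]_k) : 'rV[R]_k :=
  map_mx intr q.
Arguments intvec R {k} q.

Definition psi (R : realType) (k : nat) (phi : R -> 'rV[R]_k -> 'rV[R]_k) :
    'rV[R]_k -> 'rV[R]_k :=
  phi 1.

(* phi is a total function of t, but only its values at t >= 0 are
   constrained, so this describes a function on [0, +oo[ * E_k; continuity is
   joint and relative to that domain. *)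
Record generalised_solution (R : realType) (k : nat)
    (phi : R -> 'rV[R]_k -> 'rV[R]_k) : Prop := GeneralisedSolution {
  gsol_continuous :
    {within [set z : R * 'rV[R]_k | 0 <= z.1],
      continuous (fun z : R * 'rV[R]_k => phi z.1 z.2)};
  gsol_0 : forall eta : 'rV[R]_k, phi 0 eta = eta;
  gsol_shift : forall (t : R) (eta : 'rV[R]_k) (q : 'rV[int]_k), 0 <= t ->
    phi t (eta + intvec R q) = phi t eta + intvec R q;
  gsol_psi_shift : forall (eta : 'rV[R]_k) (q : 'rV[int]_k),
    psi phi (eta + intvec R q) = psi phi eta + intvec R q;
  gsol_flow : forall (t : R) (eta : 'rV[R]_k), 0 <= t ->
    phi (t + 1) eta = phi t (psi phi eta) }.

(* eta is a fixed point of T^m on the torus E_k / Z^k. *)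
Definition torus_fixed_point (R : realType) (k : nat)
    (T : 'rV[R]_k -> 'rV[R]_k) (m : nat) (eta : 'rV[R]_k) : Prop :=
  exists q : 'rV[int]_k, iter m T eta = eta + intvec R q.

(* Main.v *)
Require Import Defs.
From mathcomp Require Import all_boot all_order all_algebra.
From mathcomp Require Import all_classical all_reals topology normedtype.
Import Order.TTheory GRing.Theory Num.Theory.
Import numFieldNormedType.Exports.
Local Open Scope classical_set_scope.
Local Open Scope ring_scope.

(** Write [psi^n] for the [n]-th iterate of [psi].  If [psi^m eta = eta + q],
    commuting with integer translations gives
    [psi^(n + m) eta = psi^n eta + q]: each block of [m] iterations moves the
    orbit by exactly [q], so the mean displacement per iteration should be
    [rho = q / m], a vector of rationals.  Indeed the deviation
    [psi^n eta - n rho] is then periodic in [n] with period [m]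
    ([iter_deviation_periodic]), hence bounded ([periodic_bounded]), and
    dividing a bounded deviation by [n] makes it vanish in the limit
    ([cvg_mean_bounded_deviation]). *)

(** A periodic sequence takes only the values of its first period; the sum of
    their norms dominates each of them. *)
Lemma periodic_bounded (R : realType) (V : normedModType R) (m : nat)
    (d : nat -> V) :
  (0 < m)%N -> (forall n, d (n + m)%N = d n) ->
  exists B : R, forall n, `|d n| <= B.
Proof.
move=> m_gt0 d_per; exists (\sum_(i < m) `|d i|) => n.
have d_modn : d n = d (n %% m)%N.
  rewrite {1}(divn_eq n m); elim: (n %/ m)%N => [//|j IHj].
  by rewrite mulSn -addnA addnC d_per.
rewrite d_modn (bigD1 (Ordinal (ltn_pmod n m_gt0))) //= lerDl.
exact: sumr_ge0.
Qed.

(** Here [rho] is the slope of a line that [u] follows to within [B], so the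
    distance from [u n / n] to [rho] is at most [B / n] for
    [n > 0]. *)
Lemma cvg_mean_bounded_deviation (R : realType) (V : normedModType R)
    (u : nat -> V) (rho : V) (B : R) :
  (forall n, `|u n - n%:R *: rho| <= B) ->
  (fun n : nat => n%:R^-1 *: u n) @ \oo --> rho.
Proof.
move=> u_dev; apply/cvgrPdist_lt => e e_gt0.
near=> n.
have n_gt0 : 0 < n%:R :> R by near: n; exact: nbhs_infty_gtr.
have -> : rho - n%:R^-1 *: u n = - (n%:R^-1 *: (u n - n%:R *: rho)).
  by rewrite scalerBr scalerA mulVf ?gt_eqF// scale1r opprB.
rewrite normrN normrZ gtr0_norm ?invr_gt0// ltr_pdivrMl//.
apply: le_lt_trans (u_dev n) _.
(* the bound [B / n < e], read as a lower bound [B / e] on [n] *)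
rewrite -ltr_pdivrMr//.
by near: n; exact: nbhs_infty_gtr.
Unshelve. all: by end_near. Qed.

Lemma iter_shift (V : nmodType) (f : V -> V) (q : V) :
  (forall x, f (x + q) = f x + q) ->
  forall n x, iter n f (x + q) = iter n f x + q.
Proof. by move=> f_shift; elim=> [//|n IHn] x; rewrite !iterS IHn f_shift. Qed.

(** Over one period both the orbit and the line of slope [q / m] advance by
    exactly [q], since [m (q / m) = q]. *)
Lemma iter_deviation_periodic (R : realType) (V : lmodType R) (f : V -> V)
    (q x : V) (m : nat) :
  (0 < m)%N -> (forall y, f (y + q) = f y + q) -> iter m f x = x + q ->
  let d n := iter n f x - n%:R *: (m%:R^-1 *: q) in
  forall n, d (n + m)%N = d n.
Proof.
move=> m_gt0 f_shift f_m d n; rewrite /d iterD f_m iter_shift//.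
rewrite natrD scalerDl [m%:R *: _]scalerA mulfV ?pnatr_eq0 -?lt0n// scale1r.
by rewrite opprD addrACA subrr addr0.
Qed.

Theorem proposition3p3 (R : realType) (k : nat) (k_ge1 : (1 <= k)%N)
    (phi : R -> 'rV[R]_k -> 'rV[R]_k) (phi_sol : generalised_solution phi)
    (m : nat) (m_gt0 : (0 < m)%N) (eta : 'rV[R]_k)
    (eta_fix : torus_fixed_point (psi phi) m eta) :
  exists rho : 'rV[R]_k,
    ((fun n : nat => n%:R^-1 *: iter n (psi phi) eta) @ \oo --> rho) /\
    (forall p : 'I_k, exists r : rat, rho 0 p = ratr r).
Proof.
have [q psi_m] := eta_fix.
exists (m%:R^-1 *: intvec R q); split.
  have psi_shift y := gsol_psi_shift phi_sol y q.
  have [B dev_le] := periodic_bounded _ _ _ _ m_gt0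
    (iter_deviation_periodic _ _ _ _ _ _ m_gt0 psi_shift psi_m).
  exact: cvg_mean_bounded_deviation dev_le.
move=> p; exists (m%:R^-1 * (q 0 p)%:~R).
by rewrite !mxE rmorphM fmorphV rmorph_nat rmorph_int.
Qed.
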